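(* In $M^{S\mathbb{E}}$ there exist two congruence classes of equally spaced 3-point ordinary meshes with the same curvature $\kappa$ and side length $\mathsf d$: one in $SD$ and another in $\sim SD$, denoted respectively by $\gamma^{\vartriangle}_{\kappa,\mathsf d,SD}$ and $\gamma^{\vartriangle}_{\kappa,\mathsf d,\sim SD}$. Also, there is a unique congruence class of them in $M^{\mathbb{E}}$.
   Context: $S\mathbb{E}(2)=SO(2)\ltimes\mathbb{R}^2$ and $\mathbb{E}(2)=O(2)\ltimes\mathbb{R}^2$. For $\mathbb{G}\in\{S\mathbb{E},\mathbb{E}\}$, $M^{\mathbb{G}}$ is the space of all planar ordinary meshes acted on by $\mathbb{G}(2)$. A 3-point mesh is an ordered triple $\{p_1,p,p_2\}$ of successive points of $\mathbb{R}^2$; it is ordinary if it has no cusp, i.e. $p_1\neq p_2$. It is equally spaced with side length $\mathsf d$ if $|p_1-p|=|p-p_2|=\mathsf d$. Two meshes $\{p_1,p,p_2\}$, $\{q_1,q,q_2\}$ in $M^{\mathbb{G}}$ are congruent if some $g\in\mathbb{G}(2)$ satisfies $g\cdot p_1=q_1$, $g\cdot p=q$, $g\cdot p_2=q_2$. The (2-point Euclidean) curvature is $\kappa=\frac{4\Delta}{abc}$, where $a,b,c$ are the Euclidean distances between the three points and $\Delta$ is the area of the triangle with vertices $p_1,p,p_2$. The mesh is in $SD$ (the signature-direction) if $p_1,p,p_2$ are in counterclockwise order on their circumcircle, and in $\sim SD$ otherwise.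
   Formalization: The two-class claim in SE(2) is stated for κ > 0 only, since for κ = 0 all such meshes are collinear, have no circumcircle and form one class; κ and d range over the values that such meshes can have (d > 0, κ ≥ 0, κd < 2). *)

(* Defs.v *)
From mathcomp Require Import all_boot all_order all_algebra ring lra.
From mathcomp Require Import classical_sets boolp reals trigo.

Set Implicit Arguments.
Unset Strict Implicit.
Unset Printing Implicit Defensive.

Import Order.TTheory GRing.Theory Num.Theory.
Local Open Scope classical_set_scope.
Local Open Scope ring_scope.

Section Plane.
Variable R : realType.

Definition point := 'cV[R]_2.

Definition xcoord (p : point) : R := p 0 0.
Definition ycoord (p : point) : R := p 1 0.

(* The norm that the library puts on matrices is the sup norm, so the
   Euclidean distance is spelled out. *)
Definition dist (p q : point) : R :=
  Num.sqrt ((xcoord p - xcoord q) ^+ 2 + (ycoord p - ycoord q) ^+ 2).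

Definition O2 : set 'M[R]_2 := [set A | A^T *m A = 1%:M].
Definition SO2 : set 'M[R]_2 := [set A | O2 A /\ \det A = 1].

(* Underlying sets of the semidirect products of O(2) and SO(2) with R^2;
   the pair (A, b) acts on the plane as p |-> A p + b. *)
Definition E2 : set ('M[R]_2 * point) := [set g | O2 g.1].
Definition SE2 : set ('M[R]_2 * point) := [set g | SO2 g.1].
Definition act (g : 'M[R]_2 * point) (p : point) : point := g.1 *m p + g.2.

Record mesh := Mesh { fst_pt : point; mid_pt : point; last_pt : point }.

Definition ordinary (m : mesh) : Prop := fst_pt m <> last_pt m.

Definition equally_spaced (d : R) (m : mesh) : Prop :=
  dist (fst_pt m) (mid_pt m) = d /\ dist (mid_pt m) (last_pt m) = d.

Definition congruent (G : set ('M[R]_2 * point)) (m n : mesh) : Prop :=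
  exists2 g, G g & [/\ act g (fst_pt m) = fst_pt n,
                       act g (mid_pt m) = mid_pt n
                     & act g (last_pt m) = last_pt n].

Definition triangle_area (p q r : point) : R :=
  `|(xcoord q - xcoord p) * (ycoord r - ycoord p)
    - (ycoord q - ycoord p) * (xcoord r - xcoord p)| / 2.

Definition curvature (m : mesh) : R :=
  4 * triangle_area (fst_pt m) (mid_pt m) (last_pt m)
  / (dist (fst_pt m) (mid_pt m) * dist (mid_pt m) (last_pt m)
     * dist (fst_pt m) (last_pt m)).

Definition circle_point (c : point) (r t : R) : point :=
  \col_i (if i == 0 then xcoord c + r * cos t else ycoord c + r * sin t).

(* The three points are met in the order p1, p, p2 when their circumcircle is
   run through counterclockwise.  Collinear triples have no circumcircle and
   are therefore not in SD. *)
Definition SD : set mesh := [set m |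
  exists (c : point) (r t1 t t2 : R),
    [/\ 0 < r, t1 < t < t2 /\ t2 < t1 + 2 * pi,
        fst_pt m = circle_point c r t1, mid_pt m = circle_point c r t
      & last_pt m = circle_point c r t2]].

Definition spaced_meshes (kappa d : R) : set mesh :=
  [set m | [/\ ordinary m, equally_spaced d m & curvature m = kappa]].

Definition congruence_class (G : set ('M[R]_2 * point)) (m : mesh) : set mesh :=
  [set n | ordinary n /\ congruent G m n].

Definition spaced_classes (G : set ('M[R]_2 * point)) (kappa d : R) :
  set (set mesh) := congruence_class G @` spaced_meshes kappa d.

(* Only these parameters can occur.  The bound on kappa * d says that d is less
   than the diameter 2 / kappa of the circumcircle. *)
Lemma spaced_meshes_range (kappa d : R) :
  spaced_meshes kappa d !=set0 -> [/\ 0 < d, 0 <= kappa & kappa * d < 2].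
Proof.
move=> [[p q r]] []; rewrite /ordinary /equally_spaced /curvature /= => pr [].
move=> hpq hqr <-; rewrite hpq hqr.
have d0 : 0 <= d by rewrite -hpq sqrtr_ge0.
have c0 : 0 <= dist p r by rewrite sqrtr_ge0.
have sqd a b : dist a b ^+ 2
    = (xcoord a - xcoord b) ^+ 2 + (ycoord a - ycoord b) ^+ 2.
  by rewrite sqr_sqrtr// addr_ge0 ?sqr_ge0.
have eqd a b : dist a b = 0 -> a = b.
  move=> ab0; have := sqd a b; rewrite ab0 expr0n /= => /esym/eqP.
  rewrite paddr_eq0 ?sqr_ge0// !sqrf_eq0 !subr_eq0 => /andP[/eqP ex /eqP ey].
  apply/matrixP => i j; rewrite (ord1 j).
  case: i => -[|[|//]] hi.
    by rewrite (_ : Ordinal hi = 0); [exact: ex | exact/val_inj].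
  by rewrite (_ : Ordinal hi = 1); [exact: ey | exact/val_inj].
have {}c0 : 0 < dist p r.
  by rewrite lt_neqAle c0 andbT eq_sym; apply/eqP => /eqd.
have {}d0 : 0 < d.
  rewrite lt_neqAle d0 andbT eq_sym; apply/eqP => e; apply: pr.
  by rewrite (eqd p q) ?hpq// (eqd q r) ?hqr.
have Hpq := sqd p q; have Hqr := sqd q r; have Hpr := sqd p r.
rewrite hpq in Hpq; rewrite hqr in Hqr.
split=> //.
  by rewrite divr_ge0 ?mulr_ge0 ?invr_ge0 ?normr_ge0// ltW.
have -> : 4 * triangle_area p q r / (d * d * dist p r) * d
    = 2 * (2 * triangle_area p q r) / (d * dist p r).
  by field; rewrite !gt_eqF.
rewrite ltr_pdivrMr ?mulr_gt0// ltr_pM2l//.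
rewrite /triangle_area mulrC divfK ?pnatr_eq0//.
rewrite -(@ltr_pXn2r _ 2)// ?nnegrE ?normr_ge0 ?mulr_ge0 ?ltW//.
rewrite real_normK ?num_real// exprMn Hpr.
move: Hpq Hqr Hpr d0 c0; move: (dist p r) => c.
set x1 := xcoord p; set x := xcoord q; set x2 := xcoord r.
set y1 := ycoord p; set y := ycoord q; set y2 := ycoord r.
move=> Hpq Hqr Hpr d0 c0.
have c2 : 0 < (x1 - x2) ^+ 2 + (y1 - y2) ^+ 2 by rewrite -Hpr exprn_gt0.
(* Lagrange's identity, with 2 <p - q, p - r> = |p - r|^2 as the triangle is
   isosceles. *)
have -> : ((x - x1) * (y2 - y1) - (y - y1) * (x2 - x1)) ^+ 2
  = d ^+ 2 * ((x1 - x2) ^+ 2 + (y1 - y2) ^+ 2)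
    - ((x1 - x) * (x1 - x2) + (y1 - y) * (y1 - y2)) ^+ 2.
  by rewrite Hpq; ring.
have e : 2 * ((x1 - x) * (x1 - x2) + (y1 - y) * (y1 - y2))
    = (x1 - x2) ^+ 2 + (y1 - y2) ^+ 2.
  suff : (x1 - x) ^+ 2 + (y1 - y) ^+ 2 = (x - x2) ^+ 2 + (y - y2) ^+ 2 by lra.
  by rewrite -Hpq.
rewrite ltrBlDr ltrDl exprn_gt0// -(@pmulr_rgt0 _ 2)// e.
exact: c2.
Qed.

End Plane.

Arguments O2 {R}.
Arguments SO2 {R}.
Arguments E2 {R}.
Arguments SE2 {R}.
Arguments SD {R}.

(* Main.v *)
Require Import Defs.
From mathcomp Require Import all_boot all_order all_algebra ring lra.
From mathcomp Require Import classical_sets boolp reals trigo.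

Import Order.TTheory GRing.Theory Num.Theory.
Local Open Scope classical_set_scope.
Local Open Scope ring_scope.

(** The proof exhibits complete invariants.  Write [orient m] for twice the
    signed area of the triangle of [m].

    Two ordered triples with equal corresponding side lengths differ by an
    isometry: the orthonormal frame along the first side, completed according
    to the sign of [orient], is carried to the corresponding frame of the other
    triple.  The isometry has determinant 1 if the two values of [orient] agree
    and determinant -1 if they are opposite ([frame_isometry]).

    For an equally spaced mesh, Lagrange's identity expresses [orient] through
    [d] and the base [c] = |p1 - p2|, and the curvature equation
    2 |orient| = kappa d^2 c then forces c^2 = d^2 (4 - kappa^2 d^2)
    ([spaced_base]).  So kappa and d determine all side lengths and [orient] up
    to sign.  Hence the class of a mesh under E(2) is all of
    [spaced_meshes kappa d], and its class under SE(2) consists of the members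
    with the same value of [orient] ([class_E2], [class_SE2]); there is one
    class in the first case, and one for each of the two signs in the second
    when kappa > 0.

    It remains to see that nothing is empty and to match the sign of [orient]
    with SD.  An explicit isosceles triangle with sin (base angle) = kappa d / 2
    realises the parameters ([spaced_isosceles]), and exchanging its end points
    gives the other sign.  A triple in SD has [orient] > 0, because [orient] is
    a product of sines of half arcs ([SD_orient_gt0]).  Conversely the explicit
    triangle lies in SD, and SD is stable under SE(2), so its whole class, that
    is every spaced mesh with [orient] > 0, lies in SD
    ([spaced_orient_gt0_SD]). *)

(** * Planar coordinates *)

Definition mkpoint {R : realType} (x y : R) : Defs.point R :=
  \col_i (if i == 0 then x else y).

Lemma xcoord_mkpoint {R : realType} (x y : R) : xcoord (mkpoint x y) = x.
Proof. by rewrite /xcoord mxE. Qed.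

Lemma ycoord_mkpoint {R : realType} (x y : R) : ycoord (mkpoint x y) = y.
Proof. by rewrite /ycoord mxE. Qed.

Definition mkpointE {R : realType} := (@xcoord_mkpoint R, @ycoord_mkpoint R).

Lemma ord2_cases (i : 'I_2) : i = 0 \/ i = 1.
Proof. by case: i => -[|[|//]] hi; [left | right]; exact/val_inj. Qed.

Lemma point_eq {R : realType} (p q : Defs.point R) :
  xcoord p = xcoord q -> ycoord p = ycoord q -> p = q.
Proof.
move=> ex ey; apply/matrixP => i j; rewrite (ord1 j).
by case: (ord2_cases i) => ->.
Qed.

Lemma xcoord_act {R : realType} (g : 'M[R]_2 * Defs.point R) (p : Defs.point R) :
  xcoord (act g p) = g.1 0 0 * xcoord p + g.1 0 1 * ycoord p + xcoord g.2.
Proof.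
by rewrite /xcoord /ycoord !mxE !big_ord_recl big_ord0 addr0
  (_ : lift ord0 ord0 = 1) //; exact/val_inj.
Qed.

Lemma ycoord_act {R : realType} (g : 'M[R]_2 * Defs.point R) (p : Defs.point R) :
  ycoord (act g p) = g.1 1 0 * xcoord p + g.1 1 1 * ycoord p + ycoord g.2.
Proof.
by rewrite /xcoord /ycoord !mxE !big_ord_recl big_ord0 addr0
  (_ : lift ord0 ord0 = 1) //; exact/val_inj.
Qed.

Definition actE {R : realType} := (@xcoord_act R, @ycoord_act R).

Lemma det_mx2 {R : realType} (A : 'M[R]_2) :
  \det A = A 0 0 * A 1 1 - A 0 1 * A 1 0.
Proof.
rewrite (expand_det_row A 0) !big_ord_recl big_ord0 addr0 /cofactor !det_mx11.
rewrite !mxE /= (_ : lift ord0 ord0 = 1); last exact/val_inj.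
rewrite (_ : lift 1 0 = 0); last exact/val_inj.
by rewrite /= expr0 expr1; ring.
Qed.

Lemma O2P {R : realType} (A : 'M[R]_2) :
  O2 A <-> [/\ A 0 0 ^+ 2 + A 1 0 ^+ 2 = 1, A 0 1 ^+ 2 + A 1 1 ^+ 2 = 1
             & A 0 0 * A 0 1 + A 1 0 * A 1 1 = 0].
Proof.
have AAE i j : (A^T *m A) i j = A 0 i * A 0 j + A 1 i * A 1 j.
  rewrite !mxE !big_ord_recl big_ord0 addr0 !mxE.
  by rewrite (_ : lift ord0 ord0 = 1) //; exact/val_inj.
split.
  move=> /matrixP AA; move: (AA 0 0) (AA 1 1) (AA 0 1).
  by rewrite !AAE !mxE /=; split.
move=> [h0 h1 h2]; apply/matrixP => i j; rewrite AAE !mxE.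
case: (ord2_cases i) => ->; case: (ord2_cases j) => -> /=.
- by rewrite -h0 !expr2.
- by [].
- by rewrite mulr0n -h2; ring.
- by rewrite -h1 !expr2.
Qed.

Lemma dist_sqr {R : realType} (p q : Defs.point R) : dist p q ^+ 2 =
  (xcoord p - xcoord q) ^+ 2 + (ycoord p - ycoord q) ^+ 2.
Proof. by rewrite sqr_sqrtr// addr_ge0 ?sqr_ge0. Qed.

Lemma dist_ge0 {R : realType} (p q : Defs.point R) : 0 <= dist p q.
Proof. exact: sqrtr_ge0. Qed.

Lemma dist_gt0 {R : realType} (p q : Defs.point R) : p <> q -> 0 < dist p q.
Proof.
move=> pq; rewrite lt_neqAle dist_ge0 andbT eq_sym; apply/eqP => d0; apply: pq.
have := dist_sqr p q; rewrite d0 expr0n /= => /esym/eqP.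
rewrite paddr_eq0 ?sqr_ge0// !sqrf_eq0 !subr_eq0 => /andP[/eqP ex /eqP ey].
exact: point_eq.
Qed.

Lemma distP {R : realType} (p q : Defs.point R) (c : R) : 0 <= c ->
  (xcoord p - xcoord q) ^+ 2 + (ycoord p - ycoord q) ^+ 2 = c ^+ 2 ->
  dist p q = c.
Proof. by move=> c0 e; rewrite /dist e sqrtr_sqr ger0_norm. Qed.

(** * Isometries and orientation *)

Definition orient {R : realType} (m : mesh R) : R :=
  (xcoord (mid_pt m) - xcoord (fst_pt m))
    * (ycoord (last_pt m) - ycoord (fst_pt m))
  - (ycoord (mid_pt m) - ycoord (fst_pt m))
    * (xcoord (last_pt m) - xcoord (fst_pt m)).

Definition act_mesh {R : realType} (g : 'M[R]_2 * Defs.point R) (m : mesh R) :=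
  Mesh (act g (fst_pt m)) (act g (mid_pt m)) (act g (last_pt m)).

Lemma congruentP {R : realType} G (m n : mesh R) :
  congruent G m n <-> exists2 g, G g & n = act_mesh g m.
Proof.
split=> -[g Gg].
  by case: n => a b c /= [<- <- <-]; exists g.
by move=> ->; exists g.
Qed.

Lemma orient_act {R : realType} (g : 'M[R]_2 * Defs.point R) (m : mesh R) :
  orient (act_mesh g m) = \det g.1 * orient m.
Proof. by rewrite /orient /= !actE det_mx2; ring. Qed.

Lemma dist_act {R : realType} (g : 'M[R]_2 * Defs.point R) (p q : Defs.point R) :
  O2 g.1 -> dist (act g p) (act g q) = dist p q.
Proof.
move=> /O2P[h0 h1 h2]; apply: distP; first exact: dist_ge0.
rewrite dist_sqr !actE.
set A := g.1; set x := xcoord p - xcoord q; set y := ycoord p - ycoord q.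
transitivity ((A 0 0 ^+ 2 + A 1 0 ^+ 2) * x ^+ 2
  + (A 0 1 ^+ 2 + A 1 1 ^+ 2) * y ^+ 2
  + 2 * (A 0 0 * A 0 1 + A 1 0 * A 1 1) * (x * y)); first by rewrite /x /y; ring.
by rewrite h0 h1 h2; ring.
Qed.

Lemma O2_det_sqr {R : realType} (A : 'M[R]_2) : O2 A -> \det A ^+ 2 = 1.
Proof. by move=> /(congr1 determinant); rewrite det_mulmx det_tr det1 expr2. Qed.

Lemma ordinary_dist {R : realType} (m : mesh R) :
  ordinary m <-> 0 < dist (fst_pt m) (last_pt m).
Proof.
split; first exact: dist_gt0.
by move=> h e; move: h; rewrite e /dist !subrr expr0n /= addr0 sqrtr0 ltxx.
Qed.

Lemma spaced_act {R : realType} (kappa d : R) g (m : mesh R) :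
  O2 g.1 -> spaced_meshes kappa d m -> spaced_meshes kappa d (act_mesh g m).
Proof.
move=> Og [] /ordinary_dist om [e1 e2] km; split.
- by apply/ordinary_dist; rewrite dist_act.
- by split; rewrite dist_act.
- rewrite -km /curvature /= !dist_act//; congr (4 * (_ / 2) / _).
  have := orient_act g m; rewrite /orient /= => ->; rewrite normrM.
  suff -> : `|\det g.1| = 1 by rewrite mul1r.
  by apply/eqP; rewrite -sqr_norm_eq1 O2_det_sqr.
Qed.

(** With [u], [v] the sides of [m] at its mid point and [w] the side of [n]
    matching [u], the matrix (w u^T + eps Jw (Ju)^T) / |u|^2, where J is the
    quarter turn, sends the orthogonal frame (u, Ju) to (w, eps Jw).  Since a
    vector is determined by its scalar and cross products with [u], the
    hypotheses say precisely that [v] goes to the matching side of [n]. *)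
Lemma frame_isometry {R : realType} (m n : mesh R) (eps : R) :
    0 < dist (fst_pt m) (mid_pt m) ->
    dist (fst_pt m) (mid_pt m) = dist (fst_pt n) (mid_pt n) ->
    dist (mid_pt m) (last_pt m) = dist (mid_pt n) (last_pt n) ->
    dist (fst_pt m) (last_pt m) = dist (fst_pt n) (last_pt n) ->
    eps ^+ 2 = 1 -> orient n = eps * orient m ->
  exists g, [/\ O2 g.1, \det g.1 = eps & n = act_mesh g m].
Proof.
case: m => p q r; case: n => p' q' r'; rewrite /orient /= => dpq0.
move=> /(congr1 (fun x => x ^+ 2)) e1 /(congr1 (fun x => x ^+ 2)) e2.
move=> /(congr1 (fun x => x ^+ 2)) e3 eps2 eo.
move: e1 e2 e3 (dist_sqr p q); have D0 : dist p q ^+ 2 != 0.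
  by rewrite sqrf_eq0 gt_eqF.
rewrite ![in X in X -> _]dist_sqr ![in X in _ -> X -> _]dist_sqr.
rewrite ![in X in _ -> _ -> X -> _]dist_sqr.
move: D0; set D := dist p q ^+ 2 => D0 e1 e2 e3 eD.
pose u1 := xcoord p - xcoord q; pose u2 := ycoord p - ycoord q.
pose w1 := xcoord p' - xcoord q'; pose w2 := ycoord p' - ycoord q'.
pose v1 := xcoord r - xcoord q; pose v2 := ycoord r - ycoord q.
pose z1 := xcoord r' - xcoord q'; pose z2 := ycoord r' - ycoord q'.
have uD : u1 ^+ 2 + u2 ^+ 2 = D by rewrite eD.
have wD : w1 ^+ 2 + w2 ^+ 2 = D by rewrite eD e1.
have dot : u1 * v1 + u2 * v2 = w1 * z1 + w2 * z2.
  by move: e1 e2 e3; rewrite /u1 /u2 /v1 /v2 /w1 /w2 /z1 /z2; lra.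
have crs : w1 * z2 - w2 * z1 = eps * (u1 * v2 - u2 * v1).
  by move: eo; rewrite /u1 /u2 /v1 /v2 /w1 /w2 /z1 /z2; lra.
pose A : 'M[R]_2 := \matrix_(i, j)
  (((if i == 0 then w1 else w2) * (if j == 0 then u1 else u2)
    + eps * (if i == 0 then - w2 else w1) * (if j == 0 then - u2 else u1)) / D : R).
have A00 : A 0 0 = (w1 * u1 + eps * w2 * u2) / D by rewrite mxE /=; ring.
have A01 : A 0 1 = (w1 * u2 - eps * w2 * u1) / D by rewrite mxE /=; ring.
have A10 : A 1 0 = (w2 * u1 - eps * w1 * u2) / D by rewrite mxE /=; ring.
have A11 : A 1 1 = (w2 * u2 + eps * w1 * u1) / D by rewrite mxE /=; ring.
pose b := mkpoint (xcoord q' - (A 0 0 * xcoord q + A 0 1 * ycoord q))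
                  (ycoord q' - (A 1 0 * xcoord q + A 1 1 * ycoord q)).
have Ax x y : (w1 * u1 + eps * w2 * u2) / D * x + (w1 * u2 - eps * w2 * u1) / D * y
    = (w1 * (u1 * x + u2 * y) - w2 * (eps * (u1 * y - u2 * x))) / D by ring.
have Ay x y : (w2 * u1 - eps * w1 * u2) / D * x + (w2 * u2 + eps * w1 * u1) / D * y
    = (w2 * (u1 * x + u2 * y) + w1 * (eps * (u1 * y - u2 * x))) / D by ring.
exists (A, b); split => /=.
- apply/O2P; rewrite A00 A01 A10 A11; split.
  + transitivity ((u1 ^+ 2 + eps ^+ 2 * u2 ^+ 2) * (w1 ^+ 2 + w2 ^+ 2) / D ^+ 2);
      first by field.
    by rewrite eps2 mul1r uD wD -expr2 mulfV// expf_neq0.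
  + transitivity ((u2 ^+ 2 + eps ^+ 2 * u1 ^+ 2) * (w1 ^+ 2 + w2 ^+ 2) / D ^+ 2);
      first by field.
    by rewrite eps2 mul1r [_ ^+ 2 + _]addrC uD wD -expr2 mulfV// expf_neq0.
  + transitivity ((1 - eps ^+ 2) * u1 * u2 * (w1 ^+ 2 + w2 ^+ 2) / D ^+ 2);
      first by field.
    by rewrite eps2 subrr !mul0r.
- rewrite det_mx2 A00 A01 A10 A11.
  transitivity (eps * ((u1 ^+ 2 + u2 ^+ 2) * (w1 ^+ 2 + w2 ^+ 2) / D ^+ 2));
    first by field.
  by rewrite uD wD -expr2 mulfV ?mulr1// expf_neq0//.
- rewrite /act_mesh /=; congr Mesh; apply: point_eq; rewrite !actE /= !mkpointE.
  + transitivity (xcoord q' + (A 0 0 * u1 + A 0 1 * u2));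
      last by rewrite /u1 /u2; ring.
    rewrite A00 A01 Ax -!expr2 uD (mulrC u2) subrr !mulr0 subr0 mulfK//.
    by rewrite /w1; ring.
  + transitivity (ycoord q' + (A 1 0 * u1 + A 1 1 * u2));
      last by rewrite /u1 /u2; ring.
    rewrite A10 A11 Ay -!expr2 uD (mulrC u2) subrr !mulr0 addr0 mulfK//.
    by rewrite /w2; ring.
  + ring.
  + ring.
  + transitivity (xcoord q' + (A 0 0 * v1 + A 0 1 * v2));
      last by rewrite /v1 /v2; ring.
    rewrite A00 A01 Ax dot -crs.
    rewrite (_ : _ - _ = z1 * D); last by rewrite -wD; ring.
    by rewrite mulfK// /z1; ring.
  + transitivity (ycoord q' + (A 1 0 * v1 + A 1 1 * v2));
      last by rewrite /v1 /v2; ring.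
    rewrite A10 A11 Ay dot -crs.
    rewrite (_ : _ + _ = z2 * D); last by rewrite -wD; ring.
    by rewrite mulfK// /z2; ring.
Qed.

(** * Congruence classes of equally spaced meshes *)

(** Lagrange's identity; the scalar product of the sides at the first point is
    half the squared base because the triangle is isosceles. *)
Lemma spaced_orient_sqr {R : realType} (d : R) (m : mesh R) :
  equally_spaced d m -> orient m ^+ 2 =
    dist (fst_pt m) (last_pt m) ^+ 2
    * (d ^+ 2 - dist (fst_pt m) (last_pt m) ^+ 2 / 4).
Proof.
case: m => p q r [] /= /(congr1 (fun x => x ^+ 2)) e1 /(congr1 (fun x => x ^+ 2)) e2.
rewrite !dist_sqr in e1 e2 *; rewrite /orient /=.
set c2 := (xcoord p - xcoord r) ^+ 2 + (ycoord p - ycoord r) ^+ 2.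
set s := (xcoord p - xcoord q) * (xcoord p - xcoord r)
  + (ycoord p - ycoord q) * (ycoord p - ycoord r).
have hs : s = c2 / 2 by move: e1 e2; rewrite /s /c2; lra.
transitivity (c2 * d ^+ 2 - s ^+ 2); first by rewrite -e1 /c2 /s; ring.
by rewrite hs; field.
Qed.

Lemma spaced_orient_norm {R : realType} (kappa d : R) (m : mesh R) : 0 < d ->
  spaced_meshes kappa d m ->
  2 * `|orient m| = kappa * d ^+ 2 * dist (fst_pt m) (last_pt m).
Proof.
move=> d0 [] /ordinary_dist c0 [e1 e2] <-.
rewrite /curvature e1 e2 /triangle_area -/(orient m).
by field; rewrite !gt_eqF.
Qed.

(** Two formulas for [orient m ^+ 2], one from the equal sides and one from the
    curvature, both divisible by the squared base: cancelling it leaves an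
    equation that is linear in the squared base. *)
Lemma spaced_base {R : realType} (kappa d : R) (m : mesh R) : 0 < d ->
  spaced_meshes kappa d m ->
  dist (fst_pt m) (last_pt m) ^+ 2 = d ^+ 2 * (4 - kappa ^+ 2 * d ^+ 2).
Proof.
move=> d0 sm; have [/ordinary_dist c0 es _] := sm.
have := spaced_orient_sqr d m es; rewrite -real_normK ?num_real//.
have /(congr1 (fun x => x / 2)) := spaced_orient_norm kappa d m d0 sm.
rewrite [2 * `|_|]mulrC mulfK ?pnatr_eq0// => ->.
move: c0; set c := dist _ _ => c0 h.
have c20 : c ^+ 2 != 0 by rewrite sqrf_eq0 gt_eqF.
apply: (mulfI c20); move: h.
set d2 := d ^+ 2; lra.
Qed.

Lemma spaced_dist {R : realType} (kappa d : R) (m n : mesh R) : 0 < d ->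
  spaced_meshes kappa d m -> spaced_meshes kappa d n ->
  dist (fst_pt m) (last_pt m) = dist (fst_pt n) (last_pt n).
Proof.
move=> d0 sm sn; apply: (pexpIrn (n := 2)); rewrite ?nnegrE ?dist_ge0//.
by rewrite (spaced_base _ _ _ d0 sm) (spaced_base _ _ _ d0 sn).
Qed.

Lemma spaced_isometry {R : realType} (kappa d eps : R) (m n : mesh R) : 0 < d ->
  spaced_meshes kappa d m -> spaced_meshes kappa d n ->
  eps ^+ 2 = 1 -> orient n = eps * orient m ->
  exists g, [/\ O2 g.1, \det g.1 = eps & n = act_mesh g m].
Proof.
move=> d0 sm sn; have [_ [m1 m2] _] := sm; have [_ [n1 n2] _] := sn.
apply: frame_isometry; rewrite ?m1 ?m2 ?n1 ?n2//.
exact: spaced_dist sm sn.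
Qed.

Lemma class_SE2 {R : realType} (kappa d : R) (m : mesh R) : 0 < d ->
  spaced_meshes kappa d m -> congruence_class SE2 m =
    [set n | spaced_meshes kappa d n /\ orient n = orient m].
Proof.
move=> d0 sm; apply/seteqP; split=> n /=.
  move=> [_] /congruentP[g [Og dg] ->]; split; first exact: spaced_act.
  by rewrite orient_act dg mul1r.
move=> [sn eo]; split; first by case: sn.
have [||g [Og dg ->]] := spaced_isometry kappa d 1 m n d0 sm sn.
- by rewrite expr1n.
- by rewrite mul1r.
- by apply/congruentP; exists g.
Qed.

(** The classes do not see the sign of [orient], since an isometry of
    determinant -1 is allowed to reverse it; its absolute value is already
    determined by the sides. *)
Lemma class_E2 {R : realType} (kappa d : R) (m : mesh R) : 0 < d ->
  spaced_meshes kappa d m -> congruence_class E2 m = spaced_meshes kappa d.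
Proof.
move=> d0 sm; apply/seteqP; split=> n /=.
  by move=> [_] /congruentP[g Og ->]; exact: spaced_act.
move=> sn; split; first by case: sn.
have : orient m ^+ 2 = orient n ^+ 2.
  have [_ em _] := sm; have [_ en _] := sn.
  by rewrite (spaced_orient_sqr d m em) (spaced_orient_sqr d n en)
    (spaced_dist kappa d m n).
move=> /eqP; rewrite eqf_sqr => om.
have [eps eps2 eo] : exists2 eps : R, eps ^+ 2 = 1 & orient n = eps * orient m.
  case/orP: om => /eqP ->; first by exists 1; rewrite ?expr1n ?mul1r.
  by exists (-1); rewrite ?sqrrN ?expr1n ?mulN1r ?opprK.
have [g [Og _ ->]] := spaced_isometry kappa d eps m n d0 sm sn eps2 eo.
by apply/congruentP; exists g.
Qed.

(** * Existence *)

Definition isosceles {R : realType} (x y : R) : mesh R :=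
  Mesh (mkpoint (- x) y) (mkpoint 0 0) (mkpoint x y).

Definition reverse_mesh {R : realType} (m : mesh R) : mesh R :=
  Mesh (last_pt m) (mid_pt m) (fst_pt m).

Lemma distC {R : realType} (p q : Defs.point R) : dist p q = dist q p.
Proof. by rewrite /dist; congr Num.sqrt; ring. Qed.

Lemma orient_reverse {R : realType} (m : mesh R) :
  orient (reverse_mesh m) = - orient m.
Proof. by rewrite /orient /=; ring. Qed.

Lemma spaced_reverse {R : realType} (kappa d : R) (m : mesh R) :
  spaced_meshes kappa d m -> spaced_meshes kappa d (reverse_mesh m).
Proof.
move=> [om [e1 e2] <-]; split.
- by move=> e; apply: om; exact: esym.
- by split; rewrite /= distC.
- rewrite /curvature /triangle_area -/(orient m) -/(orient (reverse_mesh m)).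
  rewrite orient_reverse normrN /= (distC (last_pt m) (mid_pt m)).
  by rewrite (distC (mid_pt m) (fst_pt m)) (distC (last_pt m) (fst_pt m));
    congr (_ / (_ * _)); rewrite mulrC.
Qed.

Lemma orient_isosceles {R : realType} (x y : R) :
  orient (isosceles x y) = 2 * x * y.
Proof. by rewrite /orient /= !mkpointE; ring. Qed.

(** The base angle has sine [h] and cosine [Num.sqrt (1 - h ^+ 2)]; the sine
    rule d = (2 / kappa) sin (base angle) gives h = kappa d / 2. *)
Lemma spaced_isosceles {R : realType} (d h : R) : 0 < d -> 0 <= h < 1 ->
  spaced_meshes (2 * h / d) d (isosceles (d * Num.sqrt (1 - h ^+ 2)) (d * h)).
Proof.
move=> d0 /andP[h0 h1]; have k2 : 0 < 1 - h ^+ 2.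
  by rewrite subr_gt0 expr_lt1.
have := sqr_sqrtr (ltW k2); have : 0 < Num.sqrt (1 - h ^+ 2) by rewrite sqrtr_gt0.
move: (Num.sqrt _) => k k0 hk.
have e1 : dist (mkpoint (- (d * k)) (d * h)) (mkpoint 0 0) = d.
  apply: distP; rewrite ?ltW// !mkpointE.
  by rewrite !subr0 sqrrN !exprMn -mulrDr hk subrK mulr1.
have e2 : dist (mkpoint 0 0) (mkpoint (d * k) (d * h)) = d.
  apply: distP; rewrite ?ltW// !mkpointE.
  by rewrite !sub0r !sqrrN !exprMn -mulrDr hk subrK mulr1.
have e3 : dist (mkpoint (- (d * k)) (d * h)) (mkpoint (d * k) (d * h))
    = 2 * (d * k).
  by apply: distP; rewrite ?mulr_ge0 ?ltW// !mkpointE; ring.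
split=> //.
  by apply/ordinary_dist; rewrite /= e3 !mulr_gt0.
rewrite /curvature /= e1 e2 e3 /triangle_area.
have := orient_isosceles (d * k) (d * h); rewrite {1}/orient /= => ->.
rewrite ger0_norm; last by rewrite !mulr_ge0// ltW.
by field; rewrite !gt_eqF.
Qed.

(** * The signature direction *)

Lemma xcoord_circle {R : realType} (c : Defs.point R) (r t : R) :
  xcoord (circle_point c r t) = xcoord c + r * cos t.
Proof. by rewrite /xcoord mxE. Qed.

Lemma ycoord_circle {R : realType} (c : Defs.point R) (r t : R) :
  ycoord (circle_point c r t) = ycoord c + r * sin t.
Proof. by rewrite /ycoord mxE. Qed.

Definition circleE {R : realType} := (@xcoord_circle R, @ycoord_circle R).

(** If [2 a] and [2 b] are the two arcs, the orientation is
    4 r^2 sin a sin b sin (a + b), and all three angles are in ]0, pi[. *)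
Lemma SD_orient_gt0 {R : realType} (m : mesh R) : SD m -> 0 < orient m.
Proof.
case: m => p q s [c [r [t1 [t [t2 []]]]]] /= r0 [/andP[lt1 lt2] lt3] -> -> ->.
pose a := (t - t1) / 2; pose b := (t2 - t) / 2.
have -> : t1 = t - (a + a) by rewrite /a; field.
have -> : t2 = t + (b + b) by rewrite /b; field.
have -> : orient (Mesh (circle_point c r (t - (a + a))) (circle_point c r t)
    (circle_point c r (t + (b + b)))) = 4 * r ^+ 2 * (sin a * sin b * sin (a + b)).
  rewrite /orient /= !circleE cosB sinB !(cosD t) !(sinD t) (sinD a b).
  have cos_double x : cos (x + x) = 1 - 2 * sin x ^+ 2 :> R.
    by rewrite cosD -!expr2 cos2sin2; ring.
  have sin_double x : sin (x + x) = 2 * sin x * cos x :> R.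
    by rewrite sinD; ring.
  rewrite !cos_double !sin_double -[RHS]mul1r.
  by rewrite -[X in _ = X * _](cos2Dsin2 t); ring.
by rewrite !mulr_gt0 ?exprn_gt0// sin_gt0_pi//; rewrite /a /b; apply/andP; split; lra.
Qed.

Lemma angle_exists {R : realType} (x y : R) : x ^+ 2 + y ^+ 2 = 1 ->
  exists t, x = cos t /\ y = sin t.
Proof.
move=> e; have xB : -1 <= x <= 1.
  by rewrite -ler_norml -(@expr_le1 _ 2)// real_normK ?num_real// -e lerDl sqr_ge0.
have yE : `|y| = sin (acos x).
  by rewrite sin_acos// -e addrAC subrr add0r sqrtr_sqr.
case: (lerP 0 y) => y0.
  by exists (acos x); rewrite acosK ?in_itv//= -yE ger0_norm.
by exists (- acos x); rewrite cosN acosK ?in_itv//= sinN -yE ltr0_norm ?opprK.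
Qed.

(** A matrix of SO(2) is the rotation by some angle, by which all the parameters
    of the three points on the circumcircle are shifted. *)
Lemma SD_act {R : realType} g (m : mesh R) : SE2 g -> SD m -> SD (act_mesh g m).
Proof.
move=> [/O2P[h0 h1 h2]]; rewrite det_mx2 => h3.
have e11 : g.1 1 1 = g.1 0 0.
  transitivity (g.1 1 1 * (g.1 0 0 ^+ 2 + g.1 1 0 ^+ 2)); first by rewrite h0 mulr1.
  transitivity (g.1 0 0 * (g.1 0 0 * g.1 1 1 - g.1 0 1 * g.1 1 0)
    + g.1 1 0 * (g.1 0 0 * g.1 0 1 + g.1 1 0 * g.1 1 1)); first by ring.
  by rewrite h2 h3 mulr0 mulr1 addr0.
have e01 : g.1 0 1 = - g.1 1 0.
  transitivity (g.1 0 1 * (g.1 0 0 ^+ 2 + g.1 1 0 ^+ 2)); first by rewrite h0 mulr1.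
  transitivity (g.1 0 0 * (g.1 0 0 * g.1 0 1 + g.1 1 0 * g.1 1 1)
    - g.1 1 0 * (g.1 0 0 * g.1 1 1 - g.1 0 1 * g.1 1 0)); first by ring.
  by rewrite h2 h3 mulr0 mulr1 add0r.
have [a [ca sa]] := angle_exists _ _ h0.
have rot c r t : act g (circle_point c r t) = circle_point (act g c) r (t + a).
  by apply: point_eq; rewrite actE !circleE !actE ?cosD ?sinD ?e11 ?e01 ca sa; ring.
move=> [c [r [t1 [t [t2 []]]]]] r0 [/andP[lt1 lt2] lt3] e1 e e2.
exists (act g c), r, (t1 + a), (t + a), (t2 + a); split=> //.
- by split; [apply/andP; split|]; lra.
- by rewrite /= e1 rot.
- by rewrite /= e rot.
- by rewrite /= e2 rot.
Qed.

(** The circumcircle has its centre above the mid point at distance the radius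
    [r] = d / (2 h), and the end points are at arcs twice the base angle. *)
Lemma isosceles_SD {R : realType} (d h : R) : 0 < d -> 0 < h < 1 ->
  SD (isosceles (d * Num.sqrt (1 - h ^+ 2)) (d * h)).
Proof.
move=> d0 /andP[h0 h1]; have hB : -1 <= h <= 1 by apply/andP; split; lra.
pose a := asin h; have sa : sin a = h by rewrite asinK ?in_itv.
have ca : cos a = Num.sqrt (1 - h ^+ 2) by rewrite cos_asin.
have a_lt : a < pi / 2 by rewrite asin_ltpi2// h1 andbT; case/andP: hB.
have a_gt0 : 0 < a.
  rewrite ltNge; apply/negP => a0.
  have : 0 <= sin (- a).
    have := pi_ge0 R; have := asin_geNpi2 hB; rewrite -/a => a1 p0.
    by apply: sin_ge0_pi; apply/andP; split; lra.
  by rewrite sinN sa; lra.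
have cos_double : cos (a + a) = 1 - 2 * h ^+ 2.
  by rewrite cosD -!expr2 cos2sin2 sa; ring.
have sin_double : sin (a + a) = 2 * h * cos a by rewrite sinD sa; ring.
pose r := d / (2 * h); have r0 : 0 < r by rewrite divr_gt0// mulr_gt0.
exists (mkpoint 0 r), r, (- (pi / 2) - (a + a)), (- (pi / 2)), (- (pi / 2) + (a + a)).
split=> //.
- by split; [apply/andP; split|]; lra.
- apply: point_eq; rewrite circleE !mkpointE.
    by rewrite cosB cosN sinN cos_pihalf sin_pihalf sin_double ca /r;
      field; rewrite gt_eqF.
  by rewrite sinB cosN sinN cos_pihalf sin_pihalf cos_double /r;
    field; rewrite gt_eqF.
- apply: point_eq; rewrite circleE !mkpointE ?cosN ?sinN ?cos_pihalf ?sin_pihalf;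
    ring.
- apply: point_eq; rewrite circleE !mkpointE.
    by rewrite cosD cosN sinN cos_pihalf sin_pihalf sin_double ca /r;
      field; rewrite gt_eqF.
  by rewrite sinD cosN sinN cos_pihalf sin_pihalf cos_double /r;
    field; rewrite gt_eqF.
Qed.

(** The isosceles triangle is in SD and so has positive [orient]; the absolute
    value of [orient] being fixed by [kappa] and [d], it has the same [orient] as
    [m] and moves to [m] by an element of SE(2). *)
Lemma spaced_orient_gt0_SD {R : realType} (kappa d : R) (m : mesh R) :
  0 < d -> spaced_meshes kappa d m -> 0 < orient m -> SD m.
Proof.
move=> d0 sm om; have [om' _ _] := sm.
have k0 : 0 < kappa.
  have := spaced_orient_norm kappa d m d0 sm.
  move: om' => /ordinary_dist c0 e.
  have : 0 < kappa * (d ^+ 2 * dist (fst_pt m) (last_pt m)).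
    by rewrite mulrA -e mulr_gt0// normr_gt0 gt_eqF.
  by rewrite pmulr_lgt0// mulr_gt0// exprn_gt0.
have [_ _ kd] := spaced_meshes_range (ex_intro _ m sm).
pose h := kappa * d / 2.
have hB : 0 < h < 1.
  by rewrite /h divr_gt0 ?mulr_gt0//= ltr_pdivrMr// mul1r.
have := isosceles_SD d h d0 hB.
have := spaced_isosceles d h d0; rewrite (ltW (proj1 (andP hB))) (proj2 (andP hB)).
move=> /(_ isT); move: (isosceles _ _) => n.
rewrite (_ : 2 * h / d = kappa); last by rewrite /h; field; rewrite gt_eqF.
move=> sn nSD.
suff : congruence_class SE2 n m.
  by move=> [_] /congruentP[g Gg ->]; exact: SD_act.
rewrite (class_SE2 kappa d)//; split=> //.
have : `|orient m| = `|orient n|.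
  apply: (mulfI (x := 2)); first by rewrite pnatr_eq0.
  by rewrite !(spaced_orient_norm kappa d)// (spaced_dist kappa d m n).
by rewrite !gtr0_norm// SD_orient_gt0.
Qed.

Theorem theorem4p5 (R : realType) (kappa d : R)
    (hd : 0 < d) (hkappa : 0 <= kappa) (hkd : kappa * d < 2) :
  (0 < kappa ->
     exists C_SD C_nSD : set (mesh R),
       [/\ C_SD <> C_nSD,
           spaced_classes SE2 kappa d = [set C_SD; C_nSD],
           C_SD `<=` SD
         & C_nSD `<=` ~` SD])
  /\ (exists! C : set (mesh R), spaced_classes E2 kappa d C).
Proof.
have [n sn on] : exists2 n, spaced_meshes kappa d n & 0 <= orient n.
  pose h := kappa * d / 2.
  have hB : 0 <= h < 1.
    by rewrite /h divr_ge0 ?mulr_ge0 ?(ltW hd)//= ltr_pdivrMr// mul1r.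
  exists (isosceles (d * Num.sqrt (1 - h ^+ 2)) (d * h)).
    rewrite (_ : kappa = 2 * h / d); first exact: spaced_isosceles.
    by rewrite /h; field; rewrite gt_eqF.
  by case/andP: hB => h0 _; rewrite orient_isosceles !mulr_ge0 ?sqrtr_ge0 ?invr_ge0 ?(ltW hd).
split=> [k0|]; last first.
  exists (spaced_meshes kappa d); split; first by exists n => //; exact: class_E2.
  by move=> C [m sm <-]; rewrite (class_E2 kappa d).
have norm_orient m : spaced_meshes kappa d m -> `|orient m| = orient n.
  move=> sm; rewrite -(ger0_norm on).
  apply: (mulfI (x := 2)); first by rewrite pnatr_eq0.
  by rewrite !(spaced_orient_norm kappa d)// (spaced_dist kappa d m n).
have {}on : 0 < orient n.
  have [/ordinary_dist c0 _ _] := sn.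
  by rewrite -(norm_orient n sn) -(@pmulr_rgt0 _ 2)// (spaced_orient_norm kappa d)//
    !mulr_gt0 ?exprn_gt0.
(* The classes of [n] and of its reverse carry the two signs of [orient]. *)
have sr := spaced_reverse kappa d n sn; have or := orient_reverse n.
have cn := class_SE2 kappa d n hd sn; have cr := class_SE2 kappa d _ hd sr.
exists (congruence_class SE2 n), (congruence_class SE2 (reverse_mesh n)); split.
- move=> /seteqP[/(_ n) + _]; rewrite cn cr /= or => /(_ (conj sn erefl))[_].
  by move: on; lra.
- apply/seteqP; split=> C /=.
    move=> [m sm <-]; rewrite (class_SE2 kappa d m)// cn cr or.
    rewrite -(norm_orient m sm).
    by case: (ger0P (orient m)) => _; [left | right; rewrite opprK].
  by move=> [] ->; [exists n | exists (reverse_mesh n)].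
- rewrite cn => m [sm om]; apply: (spaced_orient_gt0_SD kappa d) => //.
  by rewrite om.
- rewrite cr => m [sm om] /SD_orient_gt0; rewrite om or.
  by move: on; lra.
Qed.
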